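(* Let $A:\operatorname{D}(A)\to\mathcal H$ be a self-adjoint operator on a Hilbert space $\mathcal H$, let $\mathcal L\subset \operatorname{D}(A)$ be a finite-dimensional subspace with $n=\dim\mathcal L$. Let $j\in\{1,\ldots,n\}$ and $t\in\mathbb R$ be fixed. The following assertions are equivalent. (a) $|F_{\mathcal L}^j(t)-F_{\mathcal L}^j(s)|= |t-s|$ for some $s\neq t$. (b) There exists an open segment $J\subset \mathbb R$ containing $t$ in its closure such that $|F_{\mathcal L}^j(t)-F_{\mathcal L}^j(s)|= |t-s|$ for all $s\in \overline{J}$. (c) There exists an open segment $J\subset \mathbb R$ containing $t$ in its closure such that, for every $s\in J$, either $\mathcal L\cap \mathcal E_{s+ F_{\mathcal L}^j(s)}(A)\neq\{0\}$ or $\mathcal L\cap \mathcal E_{s- F_{\mathcal L}^j(s)}(A)\neq\{0\}$.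
   Context: For $s\in\mathbb R$ and $u\in\operatorname{D}(A)$ put $|u|_s=\|(A-s)u\|$. For $1\le j\le n=\dim\mathcal L$, $$F_{\mathcal L}^j(s)=\min_{\substack{\dim V=j\\ V\subset\mathcal L}}\ \max_{0\ne u\in V}\frac{|u|_s}{\|u\|}.$$ For $\lambda\in\mathbb R$, $\mathcal E_\lambda(A)=\ker(A-\lambda)$ (which is $\{0\}$ if $\lambda$ is not an eigenvalue). An open segment is a non-empty open interval. The alternative ''either ... or'' in (c) is not exclusive. *)

(* Defs.v *)
From HB Require Import structures.
From mathcomp Require Import all_boot all_order all_algebra.
From mathcomp Require Import complex.
From mathcomp Require Import boolp classical_sets reals topology normedtype.

Set Implicit Arguments.
Unset Strict Implicit.
Unset Printing Implicit Defensive.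
Import Order.TTheory GRing.Theory Num.Theory numFieldNormedType.Exports.
Local Open Scope classical_set_scope.
Local Open Scope complex_scope.
Local Open Scope ring_scope.

(* A complex Hilbert space is a complete normed module H over R[i] together
   with a positive definite Hermitian form (linear on the left) inducing the
   norm of H. *)
Definition induces_norm (R : realType) (H : completeNormedModType R[i])
    (dot : {dot H for Num.conj}) : Prop :=
  forall u : H, dot u u = `|u| ^+ 2.

(* The norm of a normed module over R[i] takes its values in R[i]. *)
Definition rnorm (R : realType) (H : normedModType R[i]) (u : H) : R :=
  complex.Re `|u|.

(* A linear operator defined on a linear subspace of H; the values of [op]
   outside [dom] are irrelevant. *)
Record operator (R : realType) (H : normedModType R[i]) := Operator {
  dom : set H ;
  op :> H -> H ;
  dom0 : dom 0 ;
  dom_linear : forall (a : R[i]) (u v : H),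
    dom u -> dom v -> dom (a *: u + v) ;
  op_linear : forall (a : R[i]) (u v : H),
    dom u -> dom v -> op (a *: u + v) = a *: op u + op v }.

(* The graph of the adjoint: the pairs (v, w) such that <A u, v> = <u, w> for
   all u in the domain of A.  It is single-valued when dom A is dense. *)
Definition adjoint_graph (R : realType) (H : completeNormedModType R[i])
    (dot : {dot H for Num.conj}) (A : operator H) : set (H * H) :=
  [set vw | forall u, dom A u -> dot (A u) vw.1 = dot u vw.2].

Definition graph (R : realType) (H : normedModType R[i]) (A : operator H) :
    set (H * H) :=
  [set vw | dom A vw.1 /\ A vw.1 = vw.2].

(* A is densely defined and A = A^*. *)
Definition self_adjoint (R : realType) (H : completeNormedModType R[i])
    (dot : {dot H for Num.conj}) (A : operator H) : Prop :=
  dense (dom A) /\ graph A = adjoint_graph dot A.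

(* V is a linear subspace of dimension n, i.e. it is linearly isomorphic to the
   space of row vectors of length n (as in the axiom of vectType). *)
Definition subspace_of_dim (R : realType) (H : normedModType R[i])
    (n : nat) (V : set H) : Prop :=
  exists f : {linear 'rV[R[i]]_n -> H}, injective f /\ V = range f.

(* Least and greatest element of S, with default value 0 if there is none: these
   are genuine minima and maxima, not infima and suprema. *)
Definition minimum (R : realType) (S : set R) : R := xget 0 (S `&` lbound S).
Definition maximum (R : realType) (S : set R) : R := xget 0 (S `&` ubound S).

(* |u|_s = || (A - s) u || *)
Definition snorm (R : realType) (H : normedModType R[i]) (A : operator H)
    (s : R) (u : H) : R :=
  rnorm (A u - s%:C *: u).

Definition FL (R : realType) (H : normedModType R[i]) (A : operator H)
    (L : set H) (j : nat) (s : R) : R :=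
  minimum [set maximum [set snorm A s u / rnorm u | u in V `\ 0] |
            V in [set V | subspace_of_dim j V /\ V `<=` L]].

Definition op_eigenspace (R : realType) (H : normedModType R[i])
    (A : operator H) (lambda : R) : set H :=
  [set u | dom A u /\ A u = lambda%:C *: u].

(* A nonempty open interval, possibly unbounded. *)
Definition open_segment (R : realType) (J : set R) : Prop :=
  [/\ is_interval J, open J & J !=set0].

(* Main.v *)
Require Import Defs.
From HB Require Import structures.
From mathcomp Require Import all_boot all_order all_algebra.
From mathcomp Require Import fingroup perm.
From mathcomp Require Import complex.
From mathcomp Require Import boolp classical_sets reals topology normedtype.
From mathcomp Require Import lra ring.
Set Implicit Arguments.
Unset Strict Implicit.
Unset Printing Implicit Defensive.
Import Order.TTheory GRing.Theory Num.Theory numFieldNormedType.Exports.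
Local Open Scope classical_set_scope.
Local Open Scope ring_scope.

(** Write [F s] for [FL A L j s].  The function [F] is 1-Lipschitz, because
    [snorm A s u <= snorm A t u + |t - s| rnorm u], so the equality in (a) says
    that [F] moves at the extreme speed 1 between [t] and [s].

    From (a) to (b): the triangle inequality leaves no slack, so a pair of
    points at extreme speed forces extreme speed from [t] to every intermediate
    point, and the open interval between [t] and [s] works.

    From (a) to (c), on the same interval: from every interior point [r], [F]
    grows at speed 1 towards one of the two ends, say [w].  Take a
    [j]-dimensional [V] that is optimal at [r], and in it a [u] whose quotient
    at [w] is at least [F w].  Then
      [|(A - w) u| >= F w |u| = F r |u| + |w - r| |u| >= |(A - r) u| + |(r - w) u|]
    is an equality in the triangle inequality.  In a Hilbert space this makes
    [(A - r) u] a nonnegative multiple of [(r - w) u], of norm [F r |u|], so [u]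
    is an eigenvector for [r - F r] or [r + F r] according to the side of [w]
    ([FL_steepest_eigenvector]).

    From (c) to (a): eigenvalues of [A] with an eigenvector in [L] are
    eigenvalues of one fixed [n] by [n] matrix, so they form a finite set.  Near
    [t], the values [s + F s] and [s - F s] are close to [t + F t] and [t - F t],
    hence can only lie in that set by being equal to these; then
    [F s - F t] is [t - s] or [s - t].

    From (b) to (a), one evaluates at a point of the segment other than [t].

    Both uses of optimal spaces require the minimum and the maxima defining [F]
    to be attained.  This is the Courant-Fischer theorem ([courant_fischer]),
    proved here for the singular values of a pair of linear maps from the
    spectral theorem for Hermitian matrices, and carried over to [F] in
    [FL_minmax]. *)

(** * Simultaneous diagonalization of two Hermitian forms *)

Section HermitianForms.
Local Open Scope complex_scope.
Local Open Scope ring_scope.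
Local Open Scope sesquilinear_scope.
Context {R : realType}.

Lemma exists_sorting_perm m (d : 'I_m -> R) :
  exists s : 'S_m, forall a b : 'I_m, (a <= b)%N -> d (s a) <= d (s b).
Proof.
pose r : rel 'I_m := relpre d <=%R.
have [s sE] : exists s : 'S_m,
    sort r (ord_tuple m) = [tuple tnth (ord_tuple m) (s i) | i < m].
  by apply/tuple_permP; rewrite perm_sort.
exists s => a b leab.
have nthE (i : 'I_m) : s i = nth a (sort r (ord_tuple m)) i.
  by rewrite sE -(tnth_nth a [tuple _ | _ < _]) tnth_mktuple tnth_ord_tuple.
rewrite !nthE; apply: (@sorted_leq_nth _ r) => //.
- by move=> x y z; rewrite /r /=; exact: le_trans.
- by move=> x; rewrite /r /=.
- by apply: sort_sorted => x y; exact: le_total.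
- by rewrite inE size_sort size_tuple.
- by rewrite inE size_sort size_tuple.
Qed.

Context {H : completeNormedModType R[i]} (dot : {dot H for Num.conj}).

(** The Gram matrix of the basis vectors; for [p = q] it is the matrix of the
    form [dot] pulled back along [p]. *)
Definition pull_form m (p q : 'rV[R[i]]_m -> H) : 'M[R[i]]_m :=
  \matrix_(a, b) dot (p 'e_a) (q 'e_b).

Lemma pull_formE m (p q : {linear 'rV[R[i]]_m -> H}) x y :
  dot (p x) (q y) = (x *m pull_form p q *m y^t*) 0 0.
Proof.
rewrite {1}[x]row_sum_delta {1}[y]row_sum_delta !(linear_sum p, linear_sum q).
rewrite linear_sumr mxE; apply: eq_bigr => b _; rewrite linear_sumlz !mxE mulr_suml.
apply: eq_bigr => a _; rewrite !linearZ/= linearZl_LR /= !mxE.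
ring.
Qed.

(** The pulled back form is Hermitian, so the spectral theorem diagonalizes it
    by a unitary change of coordinates; unitarity matters because it leaves the
    standard Hermitian product intact when two diagonalizations are chained. *)
Lemma diagonalizing_basis m (p : {linear 'rV[R[i]]_m -> H}) :
  exists2 P : 'M[R[i]]_m, P \is unitarymx & exists d : 'rV[R[i]]_m,
    forall x y, dot (p (x *m P)) (p (y *m P)) = (x *m diag_mx d *m y^t*) 0 0.
Proof.
have herm : pull_form p p \is hermsymmx.
  apply/is_hermitianmxP; rewrite expr0 scale1r.
  by apply/matrixP => a b; rewrite !mxE hermC expr0 mul1r.
have /orthomx_spectralP GE := hermitian_normalmx herm.
set P := spectralmx _ in GE; set d := spectral_diag _ in GE.
have Pu : P \is unitarymx := spectral_unitarymx _.
exists P => //; exists d => x y.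
rewrite pull_formE GE invmx_unitary // trmx_mul map_mxM !mulmxA.
by rewrite (mulmxtVK _ Pu) (mulmxtVK _ Pu).
Qed.

Lemma diag_formE m (d x y : 'rV[R[i]]_m) :
  (x *m diag_mx d *m y^t*) 0 0 = \sum_a d 0 a * (x 0 a * (y 0 a)^*).
Proof.
rewrite mxE; apply: eq_bigr => a _; rewrite mul_mx_diag !mxE; ring.
Qed.

Hypothesis dotP : induces_norm dot.

Lemma rnormE (u : H) : `|u| = (rnorm u)%:C.
Proof. by rewrite /rnorm RRe_real // ger0_real. Qed.

Lemma rnorm_ge0 (u : H) : 0 <= rnorm u.
Proof. by rewrite -lecR -rnormE normr_ge0. Qed.

Lemma rnorm_eq0 (u : H) : (rnorm u == 0) = (u == 0).
Proof. by rewrite -[RHS]normr_eq0 rnormE (inj_eq (@complexI R)). Qed.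

Lemma rnorm_gt0 (u : H) : u != 0 -> 0 < rnorm u.
Proof. by move=> u0; rewrite lt0r rnorm_eq0 u0 rnorm_ge0. Qed.

Lemma dotE (u : H) : dot u u = (rnorm u ^+ 2)%:C.
Proof. by rewrite dotP rnormE rmorphXn. Qed.

Lemma dot_ge0 (u : H) : 0 <= dot u u.
Proof. by rewrite dotE lecR sqr_ge0. Qed.

(** Injectivity of [p] makes the diagonal entries positive, so the diagonal form
    can be rescaled by their square roots to the standard one. *)
Lemma orthonormalizing_basis m (p : {linear 'rV[R[i]]_m -> H}) : injective p ->
  exists2 P : 'M[R[i]]_m, P \in unitmx &
    forall x y, dot (p (x *m P)) (p (y *m P)) = (x *m y^t*) 0 0.
Proof.
move=> pI; have [P Pu [d dP]] := diagonalizing_basis p.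
have d_gt0 a : 0 < d 0 a.
  have := dP 'e_a 'e_a; rewrite diag_formE (bigD1 a) //= big1 => [|b ba].
    rewrite !mxE !eqxx/= conjC1 !mulr1 addr0 => <-.
    apply: neq0_dnorm_gt0; rewrite -(linear0 p) (inj_eq pI).
    rewrite -(mul0mx _ P) (inj_eq (can_inj (mulmxK (unitarymx_unit Pu)))).
    by apply/eqP => /rowP/(_ a)/eqP; rewrite !mxE !eqxx oner_eq0.
  by rewrite !mxE (negPf ba) andbF mul0r mulr0.
pose e := \row_a (sqrtC (d 0 a))^-1.
exists (diag_mx e *m P).
  rewrite unitmx_mul (unitarymx_unit Pu) andbT unitmxE det_diag unitfE.
  by apply/prodf_neq0 => a _; rewrite mxE invr_eq0 sqrtC_eq0 gt_eqF.
move=> x y; rewrite !mulmxA dP diag_formE mxE; apply: eq_bigr => a _.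
have dge0 := ltW (d_gt0 a).
have e_real : ((sqrtC (d 0 a))^-1)^* = (sqrtC (d 0 a))^-1.
  by rewrite conj_Creal // ger0_real // invr_ge0 sqrtC_ge0.
rewrite !mul_mx_diag !mxE rmorphM /= e_real.
rewrite -{1}[d 0 a]sqrtCK.
by field; rewrite sqrtC_eq0 gt_eqF.
Qed.

(** Singular value decomposition of [q] relative to [p]: after making [p]
    isometric, a unitary change of coordinates diagonalizes [q] without
    disturbing [p], and a permutation sorts the singular values. *)
Lemma singular_coordinates m (p q : {linear 'rV[R[i]]_m -> H}) : injective p ->
  exists2 P : 'M[R[i]]_m, P \in unitmx & exists sigma : 'I_m -> R,
  [/\ forall a, 0 <= sigma a,
      forall a b : 'I_m, (a <= b)%N -> sigma a <= sigma b,
      forall x, rnorm (p (x *m P)) ^+ 2 = \sum_a complex.Re `|x 0 a| ^+ 2 &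
      forall x, rnorm (q (x *m P)) ^+ 2 =
        \sum_a sigma a ^+ 2 * complex.Re `|x 0 a| ^+ 2].
Proof.
move=> pI; have [S Su pS] := orthonormalizing_basis pI.
pose qS : {linear 'rV[R[i]]_m -> H} := q \o mulmxr S.
have [Q Qu [d dP]] := diagonalizing_basis qS.
have d_ge0 a : 0 <= d 0 a.
  have := dP 'e_a 'e_a; rewrite diag_formE (bigD1 a) //= big1 => [|b ba].
    by rewrite !mxE !eqxx/= conjC1 !mulr1 addr0 => <-; exact: dot_ge0.
  by rewrite !mxE (negPf ba) andbF mul0r mulr0.
pose sg a := Num.sqrt (complex.Re (d 0 a)).
have [s s_le] := exists_sorting_perm sg.
have dE a : d 0 a = (sg a ^+ 2)%:C.
  have dr : d 0 a = (complex.Re (d 0 a))%:C by rewrite RRe_real // ger0_real.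
  by rewrite sqr_sqrtr // -lecR -dr.
have normE (z : R[i]) : z * z^* = (complex.Re `|z| ^+ 2)%:C.
  have zE : `|z| = (complex.Re `|z|)%:C by rewrite RRe_real // ger0_real.
  by rewrite -normCK {1}zE -rmorphXn.
have sumE (x : 'rV[R[i]]_m) (c : 'I_m -> R) :
    \sum_a c a * complex.Re `|(x *m perm_mx s) 0 a| ^+ 2 =
    \sum_a c (s a) * complex.Re `|x 0 a| ^+ 2.
  rewrite (reindex_inj (@perm_inj _ s)); apply: eq_bigr => a _.
  by rewrite -[s in perm_mx s]invgK -col_permE mxE permK.
exists (perm_mx s *m (Q *m S)).
  by rewrite !unitmx_mul unitmx_perm unitarymx_unit.
exists (sg \o s); split=> [a|a b /s_le//|x|x]; first exact: sqrtr_ge0.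
- apply: (@complexI R); rewrite -dotE !mulmxA pS trmx_mul map_mxM mulmxA mulmxtVK //.
  transitivity (\sum_a 1 * complex.Re `|(x *m perm_mx s) 0 a| ^+ 2)%:C.
    rewrite mxE rmorph_sum; apply: eq_bigr => a _.
    by rewrite mul1r; move: (normE ((x *m perm_mx s) 0 a)); rewrite !mxE.
  by rewrite sumE; congr (_%:C); apply: eq_bigr => a _; rewrite mul1r.
- apply: (@complexI R); rewrite -dotE !mulmxA -[q _]/(qS (x *m perm_mx s *m Q)) dP.
  rewrite diag_formE -(sumE x (fun a => sg a ^+ 2)) rmorph_sum.
  by apply: eq_bigr => a _; rewrite normE dE -rmorphM.
Qed.

End HermitianForms.

(** * The min-max principle *)

Section CourantFischer.
Local Open Scope complex_scope.
Local Open Scope ring_scope.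
Context {R : realType} {H : completeNormedModType R[i]}.
Context {dot : {dot H for Num.conj}} (dotP : induces_norm dot).

(** The number [mu] is the singular value of index [j], counted from 0.  The span
    of the first [j + 1] singular vectors shows that it is attained, and every
    space of dimension [j + 1] meets the span of the vectors of index at least
    [j], which is defined by [j] linear equations.  For [n = j + 1] the lemma
    says that the quotient attains its maximum on the whole space. *)
Lemma courant_fischer n j (j_lt_n : (j < n)%N) (p q : {linear 'rV[R[i]]_n -> H}) :
  injective p -> exists mu : R,
  (exists W : 'M_(j.+1, n), [/\ row_free W,
    forall y : 'rV_j.+1, rnorm (q (y *m W)) <= mu * rnorm (p (y *m W)) &
    exists2 y : 'rV_j.+1, y != 0 &
      rnorm (q (y *m W)) = mu * rnorm (p (y *m W))]) /\
  (forall W : 'M_(j.+1, n), row_free W ->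
    exists2 y : 'rV_j.+1, y != 0 &
      mu * rnorm (p (y *m W)) <= rnorm (q (y *m W))).
Proof.
move=> pI; have [P Pu [sigma [s_ge0 s_le pP qP]]] := singular_coordinates dotP q pI.
pose jn := Ordinal j_lt_n.
have sq_le (u v : H) c : 0 <= c -> rnorm u ^+ 2 <= c ^+ 2 * rnorm v ^+ 2 ->
    rnorm u <= c * rnorm v.
  by move=> c0; rewrite -exprMn ler_sqr // nnegrE ?mulr_ge0 ?rnorm_ge0.
have sq_ge (u v : H) c : 0 <= c -> c ^+ 2 * rnorm v ^+ 2 <= rnorm u ^+ 2 ->
    c * rnorm v <= rnorm u.
  by move=> c0; rewrite -exprMn ler_sqr // nnegrE ?mulr_ge0 ?rnorm_ge0.
exists (sigma jn); split.
  have coordE (y : 'rV[R[i]]_j.+1) (a : 'I_n) :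
      (y *m pid_mx j.+1) 0 a = if insub (a : nat) is Some b then y 0 b else 0.
    rewrite mxE; case: insubP => [b _ ba|].
      rewrite (bigD1 b) //= big1 => [|c cb].
        by rewrite !mxE ba eqxx -ba ltn_ord mulr1 addr0.
      by rewrite !mxE -ba (inj_eq val_inj) (negPf cb) mulr0.
    move=> ja; rewrite big1 // => c _; rewrite !mxE.
    by case: eqP => [ca|]; rewrite ?mulr0 //; move: ja; rewrite -ca ltn_ord.
  exists (pid_mx j.+1 *m P); split.
  - by rewrite /row_free mxrankMfree ?row_free_unit // rank_pid_mx.
  - move=> y; apply: sq_le => //; rewrite mulmxA pP qP mulr_sumr.
    apply: ler_sum => a _; rewrite coordE.
    case: insubP => [b _ ba|]; last by rewrite normr0 /= expr0n /= !mulr0.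
    rewrite ler_wpM2r ?sqr_ge0 // ler_sqr ?nnegrE // s_le //=.
    by rewrite -ba -ltnS ltn_ord.
  - pose e : 'rV[R[i]]_j.+1 := 'e_ord_max; exists e.
      by apply/eqP => /rowP/(_ ord_max)/eqP; rewrite !mxE !eqxx oner_eq0.
    have sqE : rnorm (q (e *m (pid_mx j.+1 *m P))) ^+ 2 =
        sigma jn ^+ 2 * rnorm (p (e *m (pid_mx j.+1 *m P))) ^+ 2.
      rewrite mulmxA pP qP mulr_sumr; apply: eq_bigr => a _.
      have [->//|aj] := eqVneq a jn.
      suff -> : (e *m pid_mx j.+1) 0 a = 0.
        by rewrite normr0 raddf0 expr0n /= !mulr0.
      rewrite coordE; case: insubP => // b _ ba; rewrite mxE.
      suff /negPf -> : b != ord_max by rewrite andbF.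
      apply: contraNneq aj => bj; apply/eqP/val_inj.
      by rewrite /= -ba bj.
    by apply/eqP; rewrite eq_le sq_le ?sq_ge ?sqE.
move=> W Wfree; pose W' := W *m invmx P.
(* The columns of B are the first j coordinates, which y must annihilate. *)
pose B : 'M_(j.+1, j) := \matrix_(b, a) W' b (widen_ord (ltnW j_lt_n) a).
have /rowV0Pn [y /sub_kermxP yB y0] : kermx B != 0.
  by rewrite -mxrank_eq0 mxrank_ker subn_eq0 -ltnNge ltnS rank_leq_col.
exists y => //; rewrite -[W](mulmxKV Pu) -/W' mulmxA; apply: sq_ge => //.
rewrite pP qP mulr_sumr; apply: ler_sum => a _.
have [aj|ja] := ltnP a j.
  suff -> : (y *m W') 0 a = 0 by rewrite normr0 /= expr0n /= !mulr0.
  move/rowP/(_ (Ordinal aj)): yB; rewrite !mxE => yB.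
  rewrite -[RHS]yB; apply: eq_bigr => b _; rewrite [in RHS]mxE; congr (_ * W' _ _).
  exact: val_inj.
by rewrite ler_wpM2r ?sqr_ge0 // ler_sqr ?nnegrE // s_le.
Qed.

Lemma maximum_eq (S : set R) m : S m -> ubound S m -> maximum S = m.
Proof.
move=> Sm mS; rewrite /maximum; case: xgetP => [x _ [Sx xS]|/(_ m)[]//].
by apply/eqP; rewrite eq_le mS // xS.
Qed.

Lemma minimum_eq (S : set R) m : S m -> lbound S m -> minimum S = m.
Proof.
move=> Sm mS; rewrite /minimum; case: xgetP => [x _ [Sx xS]|/(_ m)[]//].
by apply/eqP; rewrite eq_le mS // xS.
Qed.

(** Turns a subspace of [range f], given by its own parametrization [h], into a
    row-free matrix, the form that [courant_fischer] speaks about. *)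
Lemma factor_through_injective k n (f : {linear 'rV[R[i]]_n -> H})
    (h : {linear 'rV[R[i]]_k -> H}) : injective f -> injective h ->
  range h `<=` range f ->
  exists2 W : 'M_(k, n), row_free W & forall y, h y = f (y *m W).
Proof.
move=> fI hI hf.
have /choice[w wE] (a : 'I_k) : exists x, f x = h 'e_a.
  by have [|x _ xE] := hf (h 'e_a); [exists 'e_a|exists x].
have hE y : h y = f (y *m \matrix_a w a).
  rewrite mulmx_sum_row {1}[y]row_sum_delta !linear_sum; apply: eq_bigr => a _.
  by rewrite !linearZ /= rowK wE.
exists (\matrix_a w a) => //; rewrite -kermx_eq0.
apply/rowV0P => y /sub_kermxP yW; apply: hI.
by rewrite hE yW !linear0.
Qed.

(** [A] is linear on its domain only, so the restriction of [A - s] to the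
    finite-dimensional range of [f] is repackaged as a linear map on
    coordinates. *)
Lemma shifted_linear n (A : operator H) (f : {linear 'rV[R[i]]_n -> H}) (s : R) :
  range f `<=` dom A ->
  exists q : {linear 'rV[R[i]]_n -> H}, forall x, q x = A (f x) - s%:C *: f x.
Proof.
move=> fA; pose q x := A (f x) - s%:C *: f x.
have qlin : linear q.
  move=> a x y; rewrite /q linearP op_linear; [|by apply: fA; exists x|by apply: fA; exists y].
  by rewrite scalerDr opprD !scalerBr addrACA !scalerA [a * _]mulrC.
pose qL := GRing.isLinear.Build _ _ _ _ q qlin.
by exists (HB.pack_for {linear 'rV[R[i]]_n -> H} q qL).
Qed.

Variables (A : operator H) (n : nat) (L : set H).
Hypotheses (L_dim : subspace_of_dim n L) (L_dom : L `<=` dom A).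

(** All that is used of the definition of [FL]: some test space keeps the
    quotients below it, and no test space keeps them strictly below it. *)
Lemma FL_minmax j s : (1 <= j <= n)%N ->
  (exists2 V, subspace_of_dim j V /\ V `<=` L &
     forall u, V u -> snorm A s u <= FL A L j s * rnorm u) /\
  (forall V, subspace_of_dim j V -> V `<=` L ->
     exists2 u, V u /\ u != 0 & FL A L j s * rnorm u <= snorm A s u).
Proof.
case: j => // j /andP[_ jn]; have [f [fI LE]] := L_dim.
have [q qE] : exists q : {linear 'rV[R[i]]_n -> H},
    forall x, rnorm (q x) = snorm A s (f x).
  have [|q qE] := @shifted_linear n A f s; first by rewrite -LE.
  by exists q => x; rewrite qE.
have [mu [[W0 [W0free W0le [y0 y00 W0eq]]] mu_le]] := courant_fischer jn q fI.
have f_neq0 k (W : 'M_(k, n)) (y : 'rV_k) : row_free W -> y != 0 -> f (y *m W) != 0.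
  by move=> Wfree; rewrite -(linear0 f) (inj_eq fI) mulmx_free_eq0.
(* V0 is the span of the first singular vectors, which realizes the minimum. *)
pose V0 := range (fun y : 'rV_j.+1 => f (y *m W0)).
have V0_dim : subspace_of_dim j.+1 V0.
  exists (f \o mulmxr W0); split=> // x y /= /fI; exact: (row_free_inj W0free).
have V0L : V0 `<=` L by rewrite LE => _ [y _ <-]; exists (y *m W0).
have V0le u : V0 u -> snorm A s u <= mu * rnorm u.
  by move=> [y _ <-]; rewrite -qE.
pose ratios V := [set snorm A s u / rnorm u | u in V `\ 0].
have max_attained V : subspace_of_dim j.+1 V -> V `<=` L ->
    ratios V (maximum (ratios V)) /\ ubound (ratios V) (maximum (ratios V)).
  move=> [h [hI VE]] VL; have [|W Wfree hE] := factor_through_injective fI hI.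
    by rewrite -VE -LE.
  (* The row-free square matrix Q is invertible, so M bounds the quotient on
     all of V. *)
  have [M [[Q [Qfree Qle [y y0' Qeq]]] _]] :=
    courant_fischer (ltnSn j) (q \o mulmxr W) hI.
  suff [RM MR] : ratios V M /\ ubound (ratios V) M by rewrite (maximum_eq RM MR).
  have hQ0 : h (y *m Q) != 0 by rewrite hE -mulmxA f_neq0 // /row_free mxrankMfree.
  split.
    exists (h (y *m Q)); first by split; [rewrite VE; exists (y *m Q)|exact/eqP].
    by move: Qeq; rewrite /= qE -hE => ->; rewrite mulfK // gt_eqF ?rnorm_gt0.
  move=> _ [u [Vu /eqP u0] <-]; move: Vu u0; rewrite VE => -[z _ <-] z0.
  rewrite ler_pdivrMr ?rnorm_gt0 //.
  have := Qle (z *m invmx Q).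
  by rewrite /= mulmxKV -?row_free_unit // qE -hE.
have mu_le_max V : subspace_of_dim j.+1 V -> V `<=` L ->
    exists2 u, V u /\ u != 0 & mu * rnorm u <= snorm A s u.
  move=> [h [hI VE]] VL; have [|W Wfree hE] := factor_through_injective fI hI.
    by rewrite -VE -LE.
  have [y y0' yle] := mu_le W Wfree; exists (f (y *m W)); last by rewrite -qE.
  by split; [rewrite VE -hE; exists y|rewrite f_neq0].
suff -> : FL A L j.+1 s = mu by split=> //; exists V0.
apply: minimum_eq => [|_ [V [V_dim VL] <-]].
  exists V0 => //; apply: maximum_eq => [|_ [u [V0u /eqP u0] <-]].
    exists (f (y0 *m W0)); first by split; [exists y0|apply/eqP/f_neq0].
    by rewrite -qE W0eq mulfK // gt_eqF // rnorm_gt0 // f_neq0.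
  by rewrite ler_pdivrMr ?V0le // rnorm_gt0.
have [u [Vu u0] ule] := mu_le_max V V_dim VL.
apply: (@le_trans _ _ (snorm A s u / rnorm u)).
  by rewrite ler_pdivlMr // rnorm_gt0.
by apply: (max_attained V V_dim VL).2; exists u => //; split=> //; exact/eqP.
Qed.

End CourantFischer.

(** * Lipschitz bound and extreme speed *)

Section ExtremeSpeed.
Local Open Scope complex_scope.
Local Open Scope ring_scope.
Local Open Scope sesquilinear_scope.
Context {R : realType} {H : completeNormedModType R[i]}.
Context {dot : {dot H for Num.conj}} (dotP : induces_norm dot).

Lemma rnormD (x y : H) : rnorm (x + y) <= rnorm x + rnorm y.
Proof. by rewrite -lecR rmorphD /= -!rnormE ler_normD. Qed.

Lemma rnormZ (c : R) (x : H) : rnorm (c%:C *: x) = `|c| * rnorm x.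
Proof.
apply: (@complexI R); rewrite -rnormE normrZ rnormE rmorphM /=; congr (_ * _).
by rewrite normc_def /= expr0n addr0 sqrtr_sqr.
Qed.

(** Equality in the triangle inequality forces the real part of [dot x y] to be
    [rnorm x * rnorm y]; expanding the square of the difference of the two sides
    then gives 0. *)
Lemma rnormD_eq (x y : H) : rnorm x + rnorm y <= rnorm (x + y) ->
  (rnorm y)%:C *: x = (rnorm x)%:C *: y.
Proof.
move=> le_xy; have eq_xy : rnorm (x + y) = rnorm x + rnorm y.
  by apply/eqP; rewrite eq_le le_xy rnormD.
set a := rnorm x in eq_xy *; set b := rnorm y in eq_xy *.
have cross : dot x y + dot y x = ((a * b) *+ 2)%:C.
  have := dotE dotP (x + y); rewrite linearDl !linearDr /= !(dotE dotP) eq_xy.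
  rewrite -/a -/b sqrrD !rmorphD /= => E.
  apply: (addrI ((a ^+ 2)%:C + (b ^+ 2)%:C)).
  transitivity ((a ^+ 2)%:C + dot x y + (dot y x + (b ^+ 2)%:C)); first by ring.
  by rewrite E; ring.
apply/eqP; rewrite -subr_eq0 -rnorm_eq0 -sqrf_eq0 -(inj_eq (@complexI R)).
have conjR (c : R) : (c%:C)^* = c%:C by exact: conjc_real.
rewrite -(dotE dotP) linearBl !linearBr /= !linearZl_LR /= !linearZr_LR /=.
rewrite !(dotE dotP) -/a -/b.
rewrite !conjR; apply/eqP.
transitivity ((a ^+ 2 * b ^+ 2 *+ 2)%:C - (a * b)%:C * (dot x y + dot y x)).
  by rewrite rmorphMn !rmorphM /= ?rmorphXn /=; ring.
by rewrite cross -rmorphM -rmorphB /=; congr (_%:C); ring.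
Qed.

Variables (A : operator H) (n : nat) (L : set H).
Hypotheses (L_dim : subspace_of_dim n L) (L_dom : L `<=` dom A).

Lemma snorm_shift s t u : snorm A s u <= snorm A t u + `|t - s| * rnorm u.
Proof.
rewrite /snorm -rnormZ.
suff -> : A u - s%:C *: u = (A u - t%:C *: u) + (t - s)%:C *: u by exact: rnormD.
by rewrite rmorphB /= scalerBl addrA subrK.
Qed.

Variable j : nat.
Hypothesis j_bounds : (1 <= j <= n)%N.

Let FLj := FL A L j.

(** A vector whose quotient at [t] is at most [FL t] and at [s] is at least
    [FL s]: take a space that is optimal for [t] and maximize over it at [s].
    It compares the two values of [FL] through a single vector. *)
Lemma FL_test_vector s t : exists2 u, L u /\ u != 0 &
  FLj s * rnorm u <= snorm A s u /\ snorm A t u <= FLj t * rnorm u.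
Proof.
have [[V [V_dim VL] Vle] _] := FL_minmax dotP L_dim L_dom t j_bounds.
have [_ /(_ V V_dim VL)[u [Vu u0] ule]] := FL_minmax dotP L_dim L_dom s j_bounds.
by exists u; split => //; [exact: VL|exact: Vle].
Qed.

Lemma FL_lipschitz s t : `|FLj s - FLj t| <= `|s - t|.
Proof.
suff FLle r r' : FLj r <= FLj r' + `|r - r'|.
  by have := FLle s t; have := FLle t s; rewrite [`|t - s|]distrC ler_norml; lra.
have [u [_ u0] [le1 le2]] := FL_test_vector r r'.
have := snorm_shift r r' u; rewrite distrC => le3.
rewrite -(ler_pM2r (rnorm_gt0 u0)) mulrDl; lra.
Qed.

(** The vector that is tested at [r] and at [t] turns the equality of slopes into
    an equality in the triangle inequality for [(A - r) u] and [(r - t) u]. *)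
Lemma FL_steepest_eigenvector r t : t != r -> FLj t = FLj r + `|t - r| ->
  exists2 u, L u /\ u != 0 &
    A u = (r + FLj r)%:C *: u \/ A u = (r - FLj r)%:C *: u.
Proof.
move=> tr Ft; have [u [Lu u0] [le1 le2]] := FL_test_vector t r.
have u_gt0 := rnorm_gt0 u0; exists u => //.
set F := FLj r in Ft le2 *.
pose x := A u - r%:C *: u; pose y := (r - t)%:C *: u.
have xyE : x + y = A u - t%:C *: u.
  by rewrite /x /y rmorphB /= scalerBl addrA subrK.
have yN : rnorm y = `|t - r| * rnorm u by rewrite rnormZ distrC.
have tri := rnormD x y.
rewrite Ft in le1; have xyN : snorm A t u = rnorm (x + y) by rewrite xyE.
have xN : snorm A r u = rnorm x by [].
have xF : rnorm x = F * rnorm u.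
  by apply/eqP; rewrite eq_le -{1}xN le2 /=; move: le1 tri; rewrite xyN yN; lra.
have /rnormD_eq : rnorm x + rnorm y <= rnorm (x + y).
  by rewrite -xyN yN xF -mulrDl.
rewrite yN xF /y scalerA => xE.
have N0 : (`|t - r| * rnorm u)%:C != 0.
  rewrite -(rmorph0 (real_complex R)) (inj_eq (@complexI R)).
  by rewrite mulf_neq0 ?normr_eq0 ?subr_eq0 // gt_eqF.
have AE : A u = (r + F * ((r - t) / `|t - r|))%:C *: u.
  apply/eqP; rewrite rmorphD /= scalerDl addrC -subr_eq; apply/eqP.
  apply: (scalerI N0); rewrite xE scalerA -!rmorphM /=; congr (_%:C *: _).
  by field; rewrite normr_eq0 subr_eq0.
have [tr'|tr'|/eqP] := ltgtP t r; last by rewrite (negPf tr).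
  left; rewrite AE; congr (_%:C *: _); rewrite ltr0_norm ?subr_lt0 // opprB.
  by rewrite divff ?mulr1 // subr_eq0 gt_eqF.
right; rewrite AE; congr (_%:C *: _); rewrite gtr0_norm ?subr_gt0 //.
by rewrite -[r - t]opprB mulNr divff ?mulrN1 // subr_eq0 gt_eqF.
Qed.

Lemma op_eigenspace_neq0P lambda :
  L `&` op_eigenspace A lambda <> [set 0] <->
  exists2 u, L u /\ u != 0 & A u = lambda%:C *: u.
Proof.
split=> [LE|[u [Lu u0] Au] LE]; last first.
  have : (L `&` op_eigenspace A lambda) u by split=> //; split=> //; exact: L_dom.
  by rewrite LE => /eqP; rewrite (negPf u0).
apply: contrapT => noeig; apply: LE; apply/seteqP; split=> [u [Lu [_ Au]]|_ ->].
  by apply: contrapT => /eqP u0; apply: noeig; exists u.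
split; first by have [f [_ ->]] := L_dim; exists 0; rewrite ?linear0.
split; first exact: dom0.
have := op_linear 1 (dom0 A) (dom0 A).
by rewrite !scale1r addr0 scaler0 -[X in X = _ -> _]addr0 => /addrI.
Qed.

(** If [A u = lambda u] with [u] of coordinates [x] in [L], then pairing with [L]
    gives [x M = lambda x G] for the matrix [M] of [(u, v) |-> dot (A u) v] and
    the Gram matrix [G], so [lambda] is a root of the characteristic polynomial
    of [M G^-1], even if [A] does not map [L] to itself. *)
Lemma finitely_many_eigenvalues : exists E : seq R[i],
  forall (lambda : R) u, L u -> u != 0 -> A u = lambda%:C *: u -> lambda%:C \in E.
Proof.
have [f [fI LE]] := L_dim.
have [|q qE] := @shifted_linear R H n A f 0; first by rewrite -LE.
pose G := pull_form dot f f; pose M := pull_form dot q f.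
have Gu : G \in unitmx.
  rewrite -row_free_unit -kermx_eq0; apply/rowV0P => x /sub_kermxP xG.
  apply: fI; apply/eqP; rewrite linear0 -rnorm_eq0 -sqrf_eq0 -(inj_eq (@complexI R)).
  by rewrite -(dotE dotP) pull_formE -/G xG mul0mx mxE.
have [E EP] := closed_field_poly_normal (char_poly (M *m invmx G)).
exists E => lambda u; rewrite LE => -[x _ <-] fx0 fxE.
suff : eigenvalue (M *m invmx G) lambda%:C.
  rewrite eigenvalue_root_char EP (monicP (char_poly_monic _)) scale1r.
  by rewrite root_prod_XsubC.
apply/eigenvalueP; exists x; last by apply: contraNneq fx0 => ->; rewrite linear0.
suff xM : x *m M = lambda%:C *: (x *m G) by rewrite mulmxA xM -scalemxAl mulmxK.
have entry (z : 'rV[R[i]]_n) b : (z *m ('e_b : 'rV[R[i]]_n)^t*) 0 0 = z 0 b.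
  by rewrite trmx_delta map_delta_mx -colE mxE.
apply/rowP => b; rewrite [RHS]mxE -[LHS]entry -[(x *m G) 0 b]entry.
by rewrite -!pull_formE qE scale0r subr0 fxE linearZl_LR.
Qed.

End ExtremeSpeed.

(** * Segments and isolated values *)

Lemma punctured_closure (R : realType) (J : set R) t e : open J -> closure J t ->
  0 < e -> exists2 s, J s & s != t /\ `|s - t| < e.
Proof.
move=> Jo Jt e0; have [s0 [Js0 s0t]] := Jt _ (nbhsx_ballx t e e0).
have [s0E|s0t'] := eqVneq s0 t; last first.
  by exists s0 => //; split=> //; rewrite distrC.
have : nbhs t (J `&` ball t e).
  by apply: filterI; [apply: open_nbhs_nbhs; split=> //; rewrite -s0E|exact: nbhsx_ballx].
move=> /nbhs_ballP[d /= d0 dJ].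
have [|Js st] := dJ (t + d / 2).
  by rewrite /ball /= opprD addNKr normrN gtr0_norm; lra.
exists (t + d / 2) => //; split; last by rewrite distrC.
by rewrite -subr_eq0 addrC addKr gt_eqF // divr_gt0.
Qed.

Lemma isolated_value (R : realType) (E : seq R[i]) (c : R) : exists2 d : R, 0 < d &
  forall lambda : R, lambda%:C%C \in E -> `|lambda - c| < d -> lambda = c.
Proof.
elim: E => [|z E [d d0 dP]]; first by exists 1.
have [zc|zc] := eqVneq (complex.Re z) c.
  exists d => // lambda; rewrite inE => /orP[/eqP lz _|lE]; last exact: dP.
  by rewrite -zc -lz.
exists (Num.min d `|complex.Re z - c|).
  by rewrite lt_min d0 normr_gt0 subr_eq0.
move=> lambda; rewrite inE lt_min => /orP[/eqP zE|lE] /andP[ld lz]; last exact: dP.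
by move: lz; rewrite -zE /= ltxx.
Qed.

Lemma open_segment_itvoo (R : realType) (x y : R) : x < y ->
  let J := `]x, y[%classic in open_segment J /\ (closure J x /\ closure J y).
Proof.
move=> xy /=; split; first split.
- exact: interval_is_interval.
- exact: interval_open.
- by exists ((x + y) / 2); rewrite /= in_itv /=; lra.
split=> B /nbhs_ballP[d /= d0 dB].
  have m0 : 0 < Num.min d (y - x) by rewrite lt_min d0 subr_gt0.
  have [md my] : Num.min d (y - x) <= d /\ Num.min d (y - x) <= y - x.
    by rewrite !ge_min !lexx orbT.
  exists (x + Num.min d (y - x) / 2); split; first by rewrite /= in_itv /=; lra.
  by apply: dB; rewrite /ball /= ltr_distl; lra.
have m0 : 0 < Num.min d (y - x) by rewrite lt_min d0 subr_gt0.
have [md my] : Num.min d (y - x) <= d /\ Num.min d (y - x) <= y - x.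
  by rewrite !ge_min !lexx orbT.
exists (y - Num.min d (y - x) / 2); split; first by rewrite /= in_itv /=; lra.
by apply: dB; rewrite /ball /= ltr_distl; lra.
Qed.

(** * The equivalence *)

Theorem proposition4 (R : realType) (H : completeNormedModType R[i])
    (dot : {dot H for Num.conj}) (dotP : induces_norm dot)
    (A : operator H) (A_sa : self_adjoint dot A)
    (n : nat) (L : set H) (L_dim : subspace_of_dim n L) (L_dom : L `<=` dom A)
    (j : nat) (j_bounds : (1 <= j <= n)%N) (t : R) :
  let a := exists s : R, s <> t /\ `|FL A L j t - FL A L j s| = `|t - s| in
  let b := exists J : set R, [/\ open_segment J, closure J t &
      forall s : R, closure J s -> `|FL A L j t - FL A L j s| = `|t - s|] in
  let c := exists J : set R, [/\ open_segment J, closure J t &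
      forall s : R, J s ->
        L `&` op_eigenspace A (s + FL A L j s) <> [set 0] \/
        L `&` op_eigenspace A (s - FL A L j s) <> [set 0]] in
  (a <-> b) /\ (b <-> c).
Proof.
move=> a b c.
have lip := FL_lipschitz dotP L_dim L_dom j_bounds.
set F := FL A L j in a b c lip *.
(* Extreme speed from t to s is inherited by every r between t and s. *)
have tight s r : `|F t - F s| = `|t - s| -> `|t - s| = `|t - r| + `|r - s| ->
    `|F t - F r| = `|t - r|.
  move=> ts tr; have := lip t r; have := lip r s; have := ler_distD (F r) (F t) (F s).
  by rewrite ts tr => l1 l2 l3; apply/eqP; rewrite eq_le l3; lra.
have a_segment : a -> exists J : set R, [/\ open_segment J, closure J t,
      forall r, closure J r -> `|F t - F r| = `|t - r| &
      forall r, J r -> L `&` op_eigenspace A (r + F r) <> [set 0] \/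
        L `&` op_eigenspace A (r - F r) <> [set 0]].
  move=> [s [/eqP st Fts]].
  have [J [Jseg Jt clJ inJ]] : exists J : set R, [/\ open_segment J, closure J t,
      forall r, closure J r -> `|t - s| = `|t - r| + `|r - s| &
      forall r, J r -> t != r /\ s != r].
    have [ts|ts|ts] := ltgtP t s; last by rewrite ts eqxx in st.
      have [Jseg [Jt _]] := open_segment_itvoo ts; exists `]t, s[%classic; split=> //.
        move=> r /itv_closure /=; rewrite in_itv /= => /andP[tr rs].
        by rewrite !ler0_norm ?subr_le0 ?(ltW ts) //; ring.
      move=> r /=; rewrite in_itv /= => /andP[tr rs].
      by rewrite lt_eqF // gt_eqF.
    have [Jseg [_ Jt]] := open_segment_itvoo ts; exists `]s, t[%classic; split=> //.
      move=> r /itv_closure /=; rewrite in_itv /= => /andP[tr rs].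
      by rewrite !ger0_norm ?subr_ge0 ?(ltW ts) //; ring.
    move=> r /=; rewrite in_itv /= => /andP[tr rs].
    by rewrite gt_eqF // lt_eqF.
  exists J; split=> // r Jr; first by apply: (tight s) => //; exact: clJ.
  have tri := clJ _ (subset_closure Jr); have [tr sr] := inJ _ Jr.
  (* F is affine of slope 1 or -1 between t and s, so it increases from r
     towards one of the ends. *)
  suff [w wr Fw] : exists2 w, w != r & F w = F r + `|w - r|.
    have [u Lu [Au|Au]] := FL_steepest_eigenvector dotP L_dim L_dom j_bounds wr Fw.
      by left; apply/(op_eigenspace_neq0P L_dim L_dom); exists u.
    by right; apply/(op_eigenspace_neq0P L_dim L_dom); exists u.
  have := lip t r; have := lip r s; rewrite !ler_norml => /andP[l1 l2] /andP[l3 l4].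
  move: Fts; rewrite tri; have [_|_] := ger0P (F t - F s) => Fts.
    by exists t => //; apply/eqP; rewrite eq_le; lra.
  by exists s => //; rewrite [`|s - r|]distrC; apply/eqP; rewrite eq_le; lra.
have ab : a -> b by move=> /a_segment[J [? ? ? _]]; exists J.
have ac : a -> c by move=> /a_segment[J [? ? _ ?]]; exists J.
have ba : b -> a.
  move=> [J [[_ Jo _] Jt JF]]; have [s Js [st _]] := punctured_closure Jo Jt ltr01.
  by exists s; split; [exact/eqP|apply/JF/subset_closure].
have ca : c -> a.
  move=> [J [[_ Jo _] Jt Jeig]].
  have [E EP] := finitely_many_eigenvalues dotP L_dim L_dom.
  have eigE (lambda : R) : L `&` op_eigenspace A lambda <> [set 0] -> lambda%:C%C \in E.
    by move/(op_eigenspace_neq0P L_dim L_dom) => [u [Lu u0] Au]; exact: (EP _ u).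
  have [d1 d1_gt0 d1P] := isolated_value E (t + F t).
  have [d2 d2_gt0 d2P] := isolated_value E (t - F t).
  (* s + F s and s - F s move by at most 2 |s - t|, hence the factor 1/2. *)
  have e_gt0 : 0 < Num.min d1 d2 / 2 by rewrite divr_gt0 // lt_min d1_gt0.
  have [s Js [st]] := punctured_closure Jo Jt e_gt0.
  rewrite ltr_pdivlMr // lt_min => /andP[sd1 sd2].
  exists s; split; first exact/eqP.
  have Fst := lip s t; rewrite [`|t - s|]distrC.
  have [/eigE sE|/eigE sE] := Jeig s Js.
    have -> : F t - F s = s - t; last by [].
    suff : s + F s = t + F t by lra.
    apply: d1P => //; apply: le_lt_trans sd1.
    by rewrite opprD addrACA (le_trans (ler_normD _ _)) // mulr_natr mulr2n lerD2l.
  have -> : F t - F s = t - s; last by rewrite distrC.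
  suff : s - F s = t - F t by lra.
  apply: d2P => //; apply: le_lt_trans sd2.
  have -> : s - F s - (t - F t) = (s - t) - (F s - F t) by ring.
  by rewrite (le_trans (ler_normB _ _)) // mulr_natr mulr2n lerD2l.
by split; [split=> [/ab|/ba]|split=> [/ba/ac|/ca/ab]].
Qed.
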